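(* Let $n \in \mathbb{N}$ and let $f \colon I^n \to \mathbb{R}^{n-1}$ be continuous. Then there exist a point $p \in \mathbb{R}^{n-1}$ and a compact subset $S \subset f^{-1}[\{p\}]$ which connects some opposite faces of $I^n$.
   Context: $I^n = [0,1]^n$, $\mathbb{R}^0 = \{0\}$. For $i \in \{1,\dots,n\}$ let $I^n_{i,-} = \{z \in I^n : z_i = 0\}$ and $I^n_{i,+} = \{z \in I^n : z_i = 1\}$. A set $S \subset I^n$ connects some opposite faces of $I^n$ if $S$ is connected and there is $i$ with $S \cap I^n_{i,-} \ne \emptyset \ne S \cap I^n_{i,+}$. *)

(* Defs.v *)
From HB Require Import structures.
From mathcomp Require Import all_boot all_order all_algebra.
From mathcomp Require Import all_classical all_reals all_analysis.
Unset Printing Implicit Defensive.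
Import Order.TTheory GRing.Theory Num.Theory.
Import numFieldNormedType.Exports.
Local Open Scope classical_set_scope.
Local Open Scope ring_scope.

(* The cube I^n = [0,1]^n, points represented as row vectors 'rV[R]_n
   (with the product topology of MathComp-Analysis). *)
Definition cube (R : realType) (n : nat) : set 'rV[R]_n :=
  [set z | forall i : 'I_n, 0 <= z ord0 i <= 1].

Definition face_minus (R : realType) (n : nat) (i : 'I_n) : set 'rV[R]_n :=
  [set z | cube R n z /\ z ord0 i = 0].
Definition face_plus (R : realType) (n : nat) (i : 'I_n) : set 'rV[R]_n :=
  [set z | cube R n z /\ z ord0 i = 1].

Definition connects_opposite_faces (R : realType) (n : nat) (S : set 'rV[R]_n) : Prop :=
  connected S /\
  exists i : 'I_n, S `&` face_minus R n i !=set0 /\ S `&` face_plus R n i !=set0.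

(* Main.v *)
Require Import Defs.
From HB Require Import structures.
From mathcomp Require Import all_boot all_order all_algebra.
From mathcomp Require Import all_classical all_reals all_analysis.
From mathcomp Require Import fingroup perm zify lra.
Set Implicit Arguments.
Unset Strict Implicit.
Import Order.TTheory GRing.Theory Num.Theory.
Import numFieldNormedType.Exports.
Local Open Scope classical_set_scope.
Local Open Scope ring_scope.

(* Cut R^(n-1) into unit cells and colour each point with one of n colours so
   that every connected piece of one colour is bounded (Ostrand's covering,
   rescaled to arbitrarily small pieces). Pulled back along f to a fine grid in
   the cube, this is an n-colouring, and the n-dimensional Hex theorem gives a
   one-coloured chain of grid points joining opposite faces, on which f is nearly
   constant. A limit of such chains along an ultrafilter is a compact connected
   set joining opposite faces, on which f is constant.
   The Hex theorem is a Tucker-type statement about labels +-1, ..., +-n: if no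
   chain crosses, then label a point of colour i by +i when its monochromatic
   component meets the face x_i = 0, and by -i otherwise. There are no
   complementary edges, so each simplex of Kuhn's triangulation has an even
   number of facets labelled {+1, ..., +n}, while the boundary has exactly one.
   Counting modulo 2, bijections are counted by determinants over F_2. *)

(** * Sums and determinants modulo 2, permutations *)

Lemma addrr_F2 (x : 'F_2) : x + x = 0.
Proof. by apply: addrr_pchar2; rewrite pchar_Fp. Qed.

Lemma oppr_F2 (x : 'F_2) : - x = x.
Proof. by apply: oppr_pchar2; rewrite pchar_Fp. Qed.

Lemma signr_F2 (k : nat) (x : 'F_2) : (-1) ^+ k * x = x.
Proof. by rewrite oppr_F2 expr1n mul1r. Qed.

(** Multiplication by the odd [s] swaps even and odd permutations, so the two halves of the sum
    agree and cancel. *)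
Lemma sum_even_perm_F2 n (s : 'S_n) (F : 'S_n -> 'F_2) :
  odd_perm s -> (forall t, F (t * s)%g = F t) -> \sum_t F t = 0.
Proof.
move=> odd_s Fs; rewrite (bigID (@odd_perm _)) /= (reindex_inj (mulIg s)) /=.
rewrite (eq_bigl (fun t : 'S_n => ~~ odd_perm t)); last first.
  by move=> t; rewrite odd_permM odd_s addbT.
by under eq_bigr do rewrite Fs; exact: addrr_F2.
Qed.

Lemma det_col0 (R : comNzRingType) n (A : 'M[R]_n) j :
  (forall i, A i j = 0) -> \det A = 0.
Proof. by move=> A0; rewrite (expand_det_col _ j) big1 // => i _; rewrite A0 mul0r. Qed.

Lemma homo_ltn_perm_id n (s : 'S_n) :
  (forall i j : 'I_n, (i < j)%N -> (s i < s j)%N) -> s = 1%g.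
Proof.
have ge_id (t : 'S_n) : (forall i j : 'I_n, (i < j)%N -> (t i < t j)%N) ->
    forall i : 'I_n, (i <= t i)%N.
  move=> t_lt [i lti]; elim: i lti => //= i IHi lti.
  apply: leq_ltn_trans (IHi (ltnW lti)) _; exact: t_lt.
move=> s_lt; apply/permP => i; rewrite perm1; apply/ord_inj/eqP.
rewrite eqn_leq ge_id // andbT -{2}(permK s i) ge_id // => j k ltjk.
rewrite ltnNge leq_eqVlt; apply/negP => /orP[/eqP/val_inj/perm_inj ejk|].
  by rewrite ejk ltnn in ltjk.
by move/s_lt; rewrite !permKV ltnNge ltnW.
Qed.

Lemma val_ord_pred m (i : 'I_m.+1) : ord_pred i = (if i == ord0 then m else i.-1) :> nat.
Proof.
have lti := ltn_ord i; rewrite -val_eqE /=; case: eqP => [->|]; first by rewrite modn_small.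
move=> i0; have -> : ((i + m.+1).-1 = i.-1 + m.+1)%N by lia.
by rewrite modnDr modn_small //; lia.
Qed.

(** * A Tucker-type lemma, by counting facets modulo 2 *)

Section Tucker.
Variables (d k : nat).
Notation n := d.+1.
Notation grid := {ffun 'I_n -> 'I_k.+1}.

(** Any two grid points of one Kuhn simplex are adjacent in this sense. *)
Definition grid_adj (x y : grid) : bool :=
  [forall i, (x i <= (y i).+1)%N && (y i <= (x i).+1)%N].

Lemma grid_adj_sym : symmetric grid_adj.
Proof. by move=> x y; apply: eq_forallb => i; rewrite andbC. Qed.

(** The label of [x] is [+c x] if [s x] and [-c x] otherwise; [s_adj] excludes complementary
    edges. *)
Variables (c : grid -> 'I_n) (s : grid -> bool).
Hypothesis s_low : forall x : grid, x (c x) = ord0 -> s x.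
Hypothesis s_high : forall x : grid, x (c x) = ord_max -> ~~ s x.
Hypothesis s_adj : forall x y, grid_adj x y -> c x = c y -> s x = s y.

(* The grid is shifted by one and surrounded by a layer (some coordinate 0 or
   k.+2) with prescribed labels: the first zero coordinate if there is one, a
   negative label otherwise. Only positive labels are recorded. *)
Definition inner (x : 'I_n -> nat) : grid := [ffun i => inord (x i).-1].

Definition plab (x : 'I_n -> nat) (b : 'I_n) : bool :=
  if [exists i, x i == 0%N] then
    (x b == 0%N) && [forall j : 'I_n, (j < b)%N ==> (x j != 0%N)]
  else if [exists i, x i == k.+2] then false
  else (c (inner x) == b) && s (inner x).

Lemma plab_uniq x b b' : plab x b -> plab x b' -> b = b'.
Proof.
rewrite /plab; case: ifP => _.
  move=> /andP[xb /forallP lb] /andP[xb' /forallP lb']; apply/ord_inj/eqP.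
  case: ltngtP => // ltb; first by move: (lb' b); rewrite ltb xb.
  by move: (lb b'); rewrite ltb xb'.
by case: ifP => // _ /andP[/eqP <- _] /andP[/eqP <- _].
Qed.

Lemma plab_outer (x : 'I_n -> nat) i : x i = 0%N -> exists b, plab x b.
Proof.
move=> xi; have ex : [exists i, x i == 0%N] by apply/existsP; exists i; rewrite xi.
have Pi : x i == 0%N by rewrite xi.
case: (@arg_minnP _ i (fun j => x j == 0%N) val Pi) => b xb minb; exists b; rewrite /plab ex xb /=.
apply/forallP => j; apply/implyP => ltjb; apply/negP => /minb.
by rewrite leqNgt ltjb.
Qed.

Lemma plab_high (x : 'I_n -> nat) i : x i = k.+2 -> plab x i = false.
Proof.
move=> xi; rewrite /plab; case: ifP => _; first by rewrite xi.
by case: ifPn => // /existsPn/(_ i); rewrite xi eqxx.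
Qed.

(** If [w a] has no positive label, it has a negative one, [-i], and then [+i] occurs nowhere:
    between grid points by [s_adj], next to the outer layer by [s_low], [s_high] or the distance. *)
Lemma plab_simplex m (w : 'I_m -> 'I_n -> nat) :
  (forall a i, w a i <= k.+2)%N ->
  (forall a b i, w a i <= (w b i).+1)%N ->
  (forall a, exists b, plab (w a) b) \/ (exists b, forall a, ~~ plab (w a) b).
Proof.
move=> w_le w_adj.
have [all_p|] := boolP [forall a, exists b, plab (w a) b].
  by left=> a; apply/existsP; apply: (forallP all_p).
case/forallPn => a /existsPn no_p; right.
have no0 i : w a i != 0%N.
  by apply/eqP => /plab_outer[b pb]; move: (no_p b); rewrite pb.
have Ea : [exists i, w a i == 0%N] = false by apply/existsP => -[i]; rewrite (negbTE (no0 i)).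
have innerE (b : 'I_m) i : w b i != 0%N -> w b i != k.+2 -> inner (w b) i = (w b i).-1 :> nat.
  by move=> w0 w2; rewrite ffunE inordK //; have := w_le b i; lia.
have [/existsP[i /eqP wi]|no2] := boolP [exists i, w a i == k.+2].
  exists i => b; rewrite /plab; case: ifPn => _.
    by rewrite negb_and; have := w_adj a b i; rewrite wi; lia.
  case: ifPn => // nk; rewrite negb_and; case: eqP => //= cb.
  have wbi : w b i = k.+1.
    by move/existsPn: nk => /(_ i); have := w_adj a b i; have := w_le b i; rewrite wi; lia.
  by apply: s_high; rewrite cb; apply: ord_inj; rewrite /= innerE wbi //=; lia.
have := no_p (c (inner (w a))); rewrite {1}/plab Ea (negbTE no2) eqxx /= => sa.
exists (c (inner (w a))) => b; set i := c _; rewrite /plab; case: ifPn => [_|nb0].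
  rewrite negb_and; apply/orP; left; apply: contraNN sa => /eqP wbi.
  apply: s_low; apply: ord_inj; rewrite /= innerE //; last by move/existsPn: no2.
  by have := w_adj a b i; rewrite -/i; lia.
case: ifPn => // nb2; rewrite negb_and; case: eqP => //= cb.
rewrite (s_adj (y := inner (w a))) //; apply/forallP => j.
move/existsPn: no2 => /(_ j) ?; move/existsPn: nb2 => /(_ j) ?; move/existsPn: nb0 => /(_ j) ?.
by rewrite !innerE //; have := w_adj a b j; have := w_adj b a j; lia.
Qed.

(* The number of bijections between the first n vertices of the Kuhn simplex
   with base x and order t and the n positive labels, modulo 2. *)
Definition facet (x : 'I_n -> nat) (t : 'S_n) : 'F_2 :=
  \det (\matrix_(a < n, b < n) ((plab (fun i => x i + (t i < a))%N b)%:R : 'F_2)).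

(** Coordinate [i] is raised in step number [t i]; bases run over 0..k+1, so that vertices fill
    0..k+2. *)
Definition vertex (v : {ffun 'I_n -> 'I_k.+2}) (t : 'S_n) (l : nat) (i : 'I_n) : nat :=
  (v i + (t i < l))%N.

Definition drop_vertex v t (l : 'I_n.+1) : 'F_2 :=
  \det (\matrix_(a < n, b < n) ((plab (vertex v t (lift l a)) b)%:R : 'F_2)).

(** This is the expansion along an added column of ones of the determinant of vertices against
    labels. Either each vertex has exactly one positive label, and every row sums to 1 + 1 = 0, or
    some label is missing and its column vanishes. *)
Lemma sum_drop_vertex v t : \sum_l drop_vertex v t l = 0.
Proof.
pose A : 'M['F_2]_(n.+1) := \matrix_(l, j)
  if unlift ord0 j is Some b then (plab (vertex v t l) b)%:R else 1.
transitivity (\det A).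
  rewrite (expand_det_col _ ord0); apply: eq_bigr => l _.
  rewrite mxE unlift_none mul1r /cofactor signr_F2; congr (\det _).
  by apply/matrixP => a b; rewrite !mxE liftK.
have [||all_p|[b no_p]] := @plab_simplex n.+1 (fun l => vertex v t l).
- by move=> a i; rewrite /vertex; have := ltn_ord (v i); lia.
- by move=> a b i; rewrite /vertex; lia.
- rewrite -det_tr; apply/eqP/det0P; exists (const_mx 1).
    by apply/eqP => /rowP/(_ ord0); rewrite !mxE => /eqP; rewrite oner_eq0.
  apply/rowP => l; rewrite !mxE big_ord_recl !mxE unlift_none mulr1.
  have [b pb] := all_p l; rewrite (bigD1 b) //= !mxE liftK pb mulr1.
  rewrite big1 ?addr0 ?addrr_F2 // => b' ne_b; rewrite !mxE liftK.
  case pb' : (plab _ b'); rewrite ?mulr0 //; case/eqP: ne_b; exact: plab_uniq pb' pb.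
- apply: (@det_col0 _ _ _ (lift ord0 b)) => l.
  by rewrite mxE liftK (negbTE (no_p l)).
Qed.

(** The facet opposite an inner vertex [l] is unchanged when steps [l - 1] and [l] are exchanged, so
    the orders cancel in pairs. *)
Lemma sum_drop_middle v (l : 'I_n.+1) : (0 < l < n)%N ->
  \sum_t drop_vertex v t l = 0.
Proof.
case/andP=> l_gt0 l_lt.
have l1lt : (l.-1 < n)%N by lia.
pose i := Ordinal l1lt; pose j := Ordinal l_lt.
have ij : i != j by rewrite -val_eqE /=; lia.
apply: (@sum_even_perm_F2 _ (tperm i j)); first by rewrite odd_tperm.
move=> t; congr (\det _); apply/matrixP => a b; rewrite !mxE.
congr (plab _ b)%:R; apply: funext => q; rewrite /vertex permM; congr (_ + nat_of_bool _)%N.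
have := neq_lift l a; rewrite -val_eqE /=; set m := bump l a.
case: tpermP => [->|->|//]; rewrite /i /j /=; lia.
Qed.

(** The facet starts at vertex 1; lowering the step numbers cyclically makes the step already taken
    the last one, which a facet ignores. *)
Lemma drop_vertex0 v t (t' := (t * perm (@ord_pred_inj n))%g) :
  drop_vertex v t ord0 = facet (fun i => v i + (t' i == ord_max))%N t'.
Proof.
congr (\det _); apply/matrixP => a b; rewrite !mxE; congr (plab _ b)%:R.
apply: funext => i; rewrite /vertex -val_eqE permM permE /= [X in _ = X]/=.
have := val_ord_pred (t i); rewrite /= => ->; rewrite /bump /=.
have := ltn_ord a; have := ltn_ord (t i); case: ifPn => [/eqP ->|].
  by rewrite eqxx /=; lia.
rewrite -val_eqE /=.
by move: (nat_of_ord a) (nat_of_ord (t i)) => p q; case: eqP; lia.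
Qed.

Lemma drop_vertex_max v t : drop_vertex v t ord_max = facet (fun i => v i) t.
Proof.
by congr (\det _); apply/matrixP => a b; rewrite !mxE /vertex lift_max.
Qed.

Lemma facet_high x (t : 'S_n) i : t i = ord_max -> x i = k.+2 -> facet x t = 0.
Proof.
move=> ti xi; apply: (det_col0 (j := i)) => a; rewrite mxE (@plab_high _ i) //.
by rewrite ti xi /= ltnNge -ltnS ltn_ord addn0.
Qed.

(** In this face the label is the first zero coordinate. If all labels occur, then [v = 0], and a
    vertex labelled [b'] has every earlier coordinate raised but not [b'], so [t] is increasing. For
    [v = 0] and [t = 1] vertex [a] has label [a]. *)
Lemma facet_low (v : {ffun 'I_n -> 'I_k.+2}) (t : 'S_n) i :
  t i = ord_max -> v i = ord0 -> facet (fun j => v j) t = ((v == [ffun=> ord0]) && (t == 1%g))%:R.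
Proof.
move=> ti vi; set w := fun (a j : 'I_n) => (v j + (t j < a))%N.
have plabE a b : plab (w a) b =
    (w a b == 0%N) && [forall j : 'I_n, (j < b)%N ==> (w a j != 0%N)].
  rewrite /plab; case: ifPn => // /existsPn/(_ i).
  by rewrite /w ti vi /= ltnNge -ltnS ltn_ord.
have [[/eqP v0 /eqP t1]|nvt] := altP (andP (b1 := _ == _)).
  rewrite /facet -[RHS](det1 _ n); congr (\det _); apply/matrixP => a b.
  rewrite !mxE -/(w a) plabE /w v0 t1; congr ((nat_of_bool _)%:R); rewrite ffunE perm1 /=.
  have -> : [forall j : 'I_n, (j < b)%N ==>
      ([ffun=> ord0 : 'I_k.+2] j + ((1%g : 'S_n) j < a) != 0)%N] = (b <= a)%N.
    apply/forallP/idP => [ba|ba j]; last first.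
      by apply/implyP => jb; rewrite ffunE perm1 /= (leq_trans jb ba).
    rewrite leqNgt; apply/negP => ab; have := ba a.
    by rewrite ab ffunE perm1 ltnn.
  by rewrite -val_eqE /= ; lia.
apply/eqP; apply: contraNT nvt => facet_neq0.
have ex_row b : exists a, plab (w a) b.
  apply/existsP; apply: contraNT facet_neq0 => /existsPn no_p.
  apply/eqP/(det_col0 (j := b)) => a; by rewrite mxE -/(w a) (negbTE (no_p a)).
have v0 b : v b = ord0.
  have [a] := ex_row b; rewrite plabE => /andP[+ _]; rewrite addn_eq0 => /andP[/eqP ? _].
  exact: ord_inj.
apply/andP; split; first by apply/eqP/ffunP => b; rewrite v0 ffunE.
apply/eqP/homo_ltn_perm_id => b b' ltb.
have [a'] := ex_row b'; rewrite plabE => /andP[+ /forallP/(_ b)].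
by rewrite ltb /w !v0 /=; lia.
Qed.

(** A facet transversal to the last direction [i] is shared by the bases on its two sides, except on
    the two outer faces: the upper one contributes 0, the lower one a single facet, for [t = 1]. *)
Lemma sum_facet_ends (t : 'S_n) :
  \sum_(v : {ffun 'I_n -> 'I_k.+2})
     (facet (fun i => v i) t + facet (fun i => v i + (t i == ord_max))%N t)
  = (t == 1%g)%:R.
Proof.
set i := (t^-1)%g ord_max; have ti : t i = ord_max by rewrite permKV.
have tE j : (t j == ord_max) = (j == i) by rewrite -ti (inj_eq perm_inj).
(* The cyclic shift [h] aligns the two sides; it sends [v i = 0] to the top value [k.+1]. *)
pose h (v : {ffun 'I_n -> 'I_k.+2}) := [ffun j => if j == i then ord_pred (v j) else v j].
have h_inj : injective h.
  move=> u v /ffunP huv; apply/ffunP => j; have := huv j; rewrite !ffunE.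
  by case: eqP => // _; exact: ord_pred_inj.
rewrite big_split /= [X in _ + X](reindex_inj h_inj) -big_split /=.
have hvi (v : {ffun 'I_n -> 'I_k.+2}) : v i = ord0 -> (h v i + (t i == ord_max) = k.+2)%N.
  by move=> vi; rewrite ffunE tE eqxx val_ord_pred vi addn1.
rewrite (bigD1 [ffun=> ord0]) //= big1 ?addr0 => [|v v_neq0].
  by rewrite (facet_low ti) ?ffunE // eqxx /= (facet_high ti) ?addr0 // hvi ?ffunE.
have [vi|vi] := eqVneq (v i) ord0.
  by rewrite (facet_low ti vi) (negbTE v_neq0) add0r (facet_high ti) // hvi.
suff -> : (fun j => h v j + (t j == ord_max))%N = (fun j => val (v j)) by exact: addrr_F2.
apply: funext => j; rewrite ffunE tE; case: eqP => [->|_]; last by rewrite addn0.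
by rewrite val_ord_pred (negbTE vi); move: vi; rewrite -val_eqE /=; lia.
Qed.

(** The same sum is 0 counted simplex by simplex and 1 counted facet by facet. *)
Lemma no_tucker_labelling : False.
Proof.
have : \sum_(v : {ffun 'I_n -> 'I_k.+2}) \sum_t \sum_l drop_vertex v t l = 0.
  by rewrite big1 // => v _; rewrite big1 // => t _; exact: sum_drop_vertex.
under eq_bigr do rewrite exchange_big (bigD1 ord0) //= (bigD1 ord_max) //=.
under eq_bigr => v _.
  rewrite [X in _ + (_ + X)]big1; last first.
    move=> l /andP[l0 lm]; apply: sum_drop_middle; move: l0 lm.
    by rewrite -!val_eqE /=; have := ltn_ord l; lia.
  rewrite addr0 addrC; under eq_bigr do rewrite drop_vertex_max.
  under [X in _ + X]eq_bigr do rewrite drop_vertex0.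
  rewrite [X in _ + X](_ : _ =
      \sum_(t : 'S_n) facet (fun i => v i + (t i == ord_max))%N t); last first.
    by rewrite [RHS](reindex_inj (mulIg (perm (@ord_pred_inj n)))).
  rewrite -big_split; over.
rewrite exchange_big /=; under eq_bigr do rewrite sum_facet_ends.
rewrite (bigD1 1%g) //= big1 ?addr0 => [|t /negbTE -> //].
by rewrite eqxx => /eqP; rewrite oner_eq0.
Qed.

End Tucker.

(** * The Hex theorem and Ostrand's colouring *)

Lemma hex d k (c : {ffun 'I_d.+1 -> 'I_k.+1} -> 'I_d.+1) :
  exists x y : {ffun 'I_d.+1 -> 'I_k.+1}, [/\ x (c x) = ord0, y (c x) = ord_max &
    connect [rel u v | grid_adj u v && (c u == c v)] x y].
Proof.
set e := [rel u v | _]; have e_sym : symmetric e.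
  by move=> u v; rewrite /= grid_adj_sym eq_sym.
apply: contrapT => no_chain.
pose s v := [exists x : {ffun 'I_d.+1 -> 'I_k.+1},
  [&& x (c v) == ord0, c x == c v & connect e x v]].
apply: (@no_tucker_labelling d k c s) => [x x0|y y1|x y xy cxy].
- by apply/existsP; exists x; rewrite x0 !eqxx connect0.
- apply/existsPn => x; apply/and3P => -[/eqP x0 /eqP cxy xy]; apply: no_chain.
  by exists x, y; rewrite cxy.
have exy : e x y by rewrite /= xy cxy eqxx.
apply: eq_existsb => z; rewrite cxy; congr [&& _, _ & _].
by rewrite (same_connect1r (sym_connect_sym e_sym) exy).
Qed.

(** A unit step cannot pass a multiple of [m] without landing on it. *)
Lemma divz_step (m : nat) (u v : int) : (0 < m)%N -> `|u - v| <= 1 ->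
  ~~ (m %| u)%Z -> ~~ (m %| v)%Z -> (u %/ m)%Z = (v %/ m)%Z.
Proof.
move=> m0; wlog uv : u v / u <= v => [wl|] le1 mu mv.
  by case: (leP u v) => [|/ltW] ?; [|apply/esym]; apply: wl; rewrite // distrC.
have [->//|vE] : u = v \/ v = u + 1 by lia.
have m_neq0 : (m : int) != 0 by lia.
have := modz_ge0 u m_neq0; have := ltz_pmod u (d := m) m0.
rewrite {}vE (_ : u + 1 = (u %/ m)%Z * m + (u %% m)%Z + 1) in mv *; last by rewrite -divz_eq.
move: mu mv; rewrite (sameP dvdz_mod0P eqP).
move: (u %/ m)%Z (u %% m)%Z => q r r0 mv ltr r_ge0.
have [rm|rm] := eqVneq (r + 1) m.
  by case/negP: mv; rewrite -addrA rm rpredD ?dvdz_mull ?dvdzz.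
rewrite -addrA divzMDl // divz_small ?addr0 //; lia.
Qed.

(** Colour [x] by some [j] such that no coordinate of [F x - j] is a multiple of [d.+1]. By
    [divz_step] the quotients by [d.+1] are constant along a chain of one colour, so [F] varies by
    less than [d.+1]. *)
Lemma small_component d k (F : {ffun 'I_d.+1 -> 'I_k.+1} -> 'I_d -> int) :
  (forall x y a, grid_adj x y -> `|F x a - F y a| <= 1) ->
  exists (i : 'I_d.+1) (e : rel {ffun 'I_d.+1 -> 'I_k.+1}) (x y : {ffun 'I_d.+1 -> 'I_k.+1}),
  [/\ x i = ord0, y i = ord_max, symmetric e /\ subrel e (@grid_adj d k), connect e x y &
    forall z a, connect e x z -> `|F z a - F x a| < d.+1%:Z].
Proof.
move=> F_adj.
(* Each of the [d] coordinates rules out only one of the [d.+1] colours. *)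
have c_ex x : exists j : 'I_d.+1, forall a, ~~ (d.+1 %| F x a - j%:Z)%Z.
  apply: contrapT => no_j.
  have a_ex (j : 'I_d.+1) : exists a, (d.+1 %| F x a - j%:Z)%Z.
    apply: contrapT => no_a; apply: no_j; exists j => a.
    by apply/negP => ?; apply: no_a; exists a.
  have [r rE] := choice a_ex.
  have r_inj : injective r.
    move=> i j rij; have := rE j; rewrite -rij => dj; have di := rE i.
    have := rpredB dj di; rewrite opprB addrC addrA subrK.
    move/dvdzP => [q /eqP]; rewrite subr_eq => /eqP ijE.
    apply: ord_inj; have := ltn_ord i; have := ltn_ord j.
    have : q <= -1 \/ q = 0 \/ 1 <= q by lia.
    by case=> [q1|[q0|q1]]; nia.
  by have := leq_card r r_inj; rewrite !card_ord ltnn.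
have [c cE] := choice c_ex.
have [x [y [x0 y1 xy]]] := hex c.
exists (c x), [rel u v | grid_adj u v && (c u == c v)], x, y; split=> //.
  split=> [u v|u v /andP[] //]; by rewrite /= grid_adj_sym eq_sym.
pose q u a := ((F u a - (c x)%:Z) %/ d.+1)%Z.
move=> z a /connectP[p pth ->] {z}.
have [cz qz] : c (last x p) = c x /\ q (last x p) a = q x a.
  elim/last_ind: p pth => //= p z IHp; rewrite rcons_path last_rcons => /andP[/IHp[cp qp]].
  move=> /= /andP[adj /eqP cpz]; have cz : c z = c x by rewrite -cpz.
  split=> //; rewrite -qp; apply: divz_step => //.
  - by rewrite opprD addrACA opprK addNr addr0 distrC F_adj.
  - by have := cE z a; rewrite cz.
  - by have := cE (last x p) a; rewrite cp.
have := divz_eq (F (last x p) a - (c x)%:Z) d.+1; rewrite -/(q _ _) qz.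
have := divz_eq (F x a - (c x)%:Z) d.+1; rewrite -/(q _ _).
have := modz_ge0 (F x a - (c x)%:Z) (d := d.+1) isT.
have := modz_ge0 (F (last x p) a - (c x)%:Z) (d := d.+1) isT.
have := ltz_pmod (F x a - (c x)%:Z) (d := d.+1) isT.
have := ltz_pmod (F (last x p) a - (c x)%:Z) (d := d.+1) isT.
move: (_ * _) (_ %% _)%Z (_ %% _)%Z => t r s.
by move: (F _ _) (F _ _) (Posz (c x)) => u v w; lia.
Qed.

(** * Limits along an ultrafilter *)

(** For an ultrafilter a cluster point is a limit, so no subsequences are extracted. *)
Lemma ultra_seq_cvg (T : topologicalType) (U : set_system nat) (C : set T) (u : nat -> T) :
  UltraFilter U -> compact C -> (forall m, C (u m)) ->
  exists2 x, C x & u @ U --> x.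
Proof.
move=> UU cC Cu; have PF := @ultra_proper _ _ UU.
have uC : U (u @^-1` C) by exact: filterE.
have [x [Cx clx]] := cC (u @ U) _ uC.
exists x => // N Nx; have [//|UN] := in_ultra_setVsetC (u @^-1` N) UU.
by have [z [/= nNz Nz]] := clx (~` N) N UN Nx.
Qed.

Section UltraLimit.
Variables (R : realType) (T : pseudoMetricType R) (U : set_system nat).
Hypothesis UU : UltraFilter U.
Local Instance UP : ProperFilter U := @ultra_proper _ _ UU.
Variables (e : nat -> R).
Hypothesis e_cvg : forall r : R, 0 < r -> U [set m | e m < r].

Lemma ultra_cvg_close (u v : nat -> T) (x : T) :
  U [set m | ball (u m) (e m) (v m)] -> u @ U --> x -> v @ U --> x.
Proof.
move=> Uuv ux; apply/cvg_ballP => r r0.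
have r2 : 0 < r / 2 by rewrite divr_gt0.
move/cvg_ballP : ux => /(_ _ r2) ux.
near=> m; rewrite (splitr r); apply: (@ball_triangle _ _ (u m)); first by near: m.
apply: (@le_ball _ _ _ (e m)); last by near: m.
by apply: ltW; near: m; exact: e_cvg.
Unshelve. all: by end_near. Qed.

(* The limit of the sets K m in the Hausdorff sense along U. *)
Definition ultra_limit (K : nat -> set T) : set T :=
  [set x | forall N, nbhs x N -> U [set m | K m `&` N !=set0]].

Lemma ultra_limit_closed K : closed (ultra_limit K).
Proof.
move=> x clx N; rewrite nbhsE => -[V [oV Vx] VN].
have [y [Ky Vy]] := clx V (open_nbhs_nbhs (conj oV Vx)).
apply: filterS (Ky V (open_nbhs_nbhs (conj oV Vy))) => m [z [Kz Vz]].
by exists z; split=> //; exact: VN.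
Qed.

Lemma ultra_limit_mem K (u : nat -> T) (x : T) :
  U [set m | K m (u m)] -> u @ U --> x -> ultra_limit K x.
Proof.
by move=> Ku ux N /ux UN; near=> m; exists (u m); split; near: m.
Unshelve. all: by end_near. Qed.

(** Connectedness at scale [r], put as a condition on splittings: a separation of the limit
    contradicts it directly. *)
Definition chained (r : R) (K : set T) := forall W : set T,
  K `&` W !=set0 -> K `\` W !=set0 ->
  exists x y, [/\ K x, W x, K y, ~ W y & ball x r y].

(** Suppose [B] splits the limit. A set [W] that is a neighbourhood of [B], with complement a
    neighbourhood of the rest, splits [K m] for [U]-many [m]. The short steps out of [W] converge to
    a point of the limit, which can lie neither in [B] nor outside. *)
Lemma ultra_limit_connected K (C : set T) :
  compact C -> (forall m, K m `<=` C) -> (forall m, chained (e m) (K m)) ->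
  connected (ultra_limit K).
Proof.
set S := ultra_limit K => cC KC Kch B [b Bb] [V oV BV] [D cD BD].
have BS : B `<=` S by rewrite BV => z [].
apply: contrapT => BneS.
have [s Ss nBs] : exists2 s, S s & ~ B s.
  apply: contrapT => no; apply: BneS; apply/seteqP; split=> // z Sz.
  by apply: contrapT => nBz; apply: no; exists z.
(* Tripling the radius leaves room for the triangle inequality in [W_far]. *)
pose W := [set z | exists b r, [/\ B b, 0 < r, ball b r z &
  forall y, S y -> ball b (3 * r) y -> B y]].
have W_nbhs z : B z -> nbhs z W.
  move=> Bz; have : nbhs z V by apply: open_nbhs_nbhs; split=> //; move: Bz; rewrite BV => -[].
  move=> /nbhs_ballP[r /= r0 rV]; have r3 : 0 < r / 3 by rewrite divr_gt0.
  apply/nbhs_ballP; exists (r / 3) => //= y zy; exists z, (r / 3); split=> // y' Sy' zy'.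
  by rewrite BV; split=> //; apply: rV; congr (ball _ _ _): zy'; rewrite mulrC divfK.
have W_far y : S y -> ~ B y -> nbhs y (~` W).
  move=> Sy nBy; have : nbhs y (~` D).
    apply: open_nbhs_nbhs; split; first exact: closed_openC.
    by move=> Dy; apply: nBy; rewrite BD.
  move=> /nbhs_ballP[r /= r0 rD]; have r3 : 0 < r / 3 by rewrite divr_gt0.
  apply/nbhs_ballP; exists (r / 3) => //= z yz [a [t [Ba t0 az far]]].
  have [le_rt|lt_tr] := leP (r / 3) t.
    apply: nBy; apply: far => //; apply: (@le_ball _ _ _ (t + r / 3)); first lra.
    by apply: ball_triangle az _; exact: ball_sym.
  apply: (rD a); last by move: Ba; rewrite BD => -[].
  apply: (@le_ball _ _ _ (r / 3 + t)); first lra.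
  by apply: ball_triangle yz _; exact: ball_sym.
pose cond m := K m `&` W !=set0 /\ K m `\` W !=set0.
have Ucond : U [set m | cond m].
  have Ub := BS _ Bb _ (W_nbhs _ Bb); have Us := Ss _ (W_far _ Ss nBs).
  exact: (filterI Ub Us).
have [m0 [[c0 [/KC Cc0 _]] _]] := filter_ex Ucond.
have xy_ex m : exists p : T * T, [/\ C p.1, C p.2 & cond m ->
    [/\ K m p.1, W p.1, ~ W p.2 & ball p.1 (e m) p.2]].
  have [cm|ncm] := pselect (cond m); last by exists (c0, c0).
  have [x [y [Kx Wx Ky nWy xy]]] := Kch m W cm.1 cm.2.
  by exists (x, y); split=> /=; [exact: (KC m)|exact: (KC m)|].
have [p pE] := choice xy_ex.
have Cp1 m : C (p m).1 by have [] := pE m.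
have [x Cx p1x] := ultra_seq_cvg UU cC Cp1.
have p2x : (fun m => (p m).2) @ U --> x.
  apply: (ultra_cvg_close _ p1x); apply: filterS Ucond => m cm.
  by have [_ _ /(_ cm)[]] := pE m.
have Sx : S x.
  apply: (ultra_limit_mem _ p1x); apply: filterS Ucond => m cm.
  by have [_ _ /(_ cm)[]] := pE m.
have [Bx|nBx] := pselect (B x).
  have UW : U [set m | W (p m).2] := p2x _ (W_nbhs _ Bx).
  have [m [cm]] := filter_ex (filterI Ucond UW).
  by have [_ _ /(_ cm)[]] := pE m.
have UW : U [set m | ~ W (p m).1] := p1x _ (W_far _ Sx nBx).
have [m [cm]] := filter_ex (filterI Ucond UW).
by have [_ _ /(_ cm)[]] := pE m.
Qed.
End UltraLimit.

Lemma ultra_natSinv (R : realType) :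
  exists2 U : set_system nat, UltraFilter U & forall r : R, 0 < r -> U [set m | m.+1%:R^-1 < r].
Proof.
have [U [UU ooU]] := ultraFilterLemma eventually_filter.
exists U => // r r0; apply: ooU; exact: (near_infty_natSinv_lt (PosNum r0)).
Qed.

Lemma within_continuous_seq (T V : topologicalType) (U : set_system nat) (C : set T) (f : T -> V)
    (u : nat -> T) (x : T) :
  Filter U -> {within C, continuous f} -> (forall m, C (u m)) -> C x -> u @ U --> x ->
  f \o u @ U --> f x.
Proof.
move=> FU /subspace_continuousP cf Cu Cx ux N Nfx.
have CN : U [set m | C (u m) -> N (f (u m))] := ux _ (cf x Cx N Nfx).
suff : U [set m | N (f (u m))] by [].
by apply: filterS CN => m; apply; exact: Cu.
Qed.

(** Heine-Cantor: bad pairs at distance below [1/(m+1)] have a common limit along [U], where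
    continuity within [C] is contradicted. *)
Lemma compact_uniform (R : realType) (T V : pseudoMetricType R) (C : set T) (f : T -> V) r :
  compact C -> {within C, continuous f} -> 0 < r ->
  exists2 t, 0 < t & forall x y, C x -> C y -> ball x t y -> ball (f x) r (f y).
Proof.
move=> cC cf r0; apply: contrapT => no_t.
have ex_bad (m : nat) : exists p : T * T,
    [/\ C p.1, C p.2, ball p.1 (m.+1%:R^-1) p.2 & ~ ball (f p.1) r (f p.2)].
  apply: contrapT => no_p; apply: no_t; exists m.+1%:R^-1 => [|x y Cx Cy xy].
    by rewrite invr_gt0.
  by apply: contrapT => nfxy; apply: no_p; exists (x, y).
have [p pE] := choice ex_bad.
have Cp1 m : C (p m).1 by have [] := pE m.
have Cp2 m : C (p m).2 by have [] := pE m.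
have [U UU Ue] := ultra_natSinv R; have PU := @ultra_proper _ _ UU.
have [x Cx p1x] := ultra_seq_cvg UU cC Cp1.
have p2x : (fun m => (p m).2) @ U --> x.
  by apply: (ultra_cvg_close UU Ue _ p1x); apply: filterE => m; have [] := pE m.
have r2 : 0 < r / 2 by rewrite divr_gt0.
have U1 : U [set m | ball (f x) (r / 2) (f (p m).1)] .
  by apply: (within_continuous_seq _ cf Cp1 Cx p1x (nbhsx_ballx (f x) _ r2)).
have U2 : U [set m | ball (f x) (r / 2) (f (p m).2)] .
  by apply: (within_continuous_seq _ cf Cp2 Cx p2x (nbhsx_ballx (f x) _ r2)).
have [m [/= m1 m2]] := filter_ex (filterI U1 U2).
by have [_ _ _] := pE m; apply; rewrite (splitr r); apply: ball_triangle m2; exact: ball_sym.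
Qed.

(** * The cube and its grid approximations *)

Lemma cube_compact (R : realType) n : compact (cube R n).
Proof.
have := rV_compact (fun _ : 'I_n => @segment_compact R 0 1).
by congr compact; apply/seteqP; split=> v /= vI i; have := vI i; rewrite /= in_itv.
Qed.

Lemma cube_closed (R : realType) n : closed (cube R n).
Proof.
have -> : cube R n = \bigcap_(i in [set: 'I_n]) (fun v => v ord0 i) @^-1` `[0, 1].
  apply/seteqP; split=> v /= vI i; first by move=> _; rewrite /= in_itv; exact: vI.
  by have := vI i I; rewrite /= in_itv.
apply: closed_bigI => i _; apply: preimage_closed; last exact: interval_closed.
by move=> v _; exact: coord_continuous.
Qed.

Lemma connect_exit (T : finType) (e : rel T) (P : T -> Prop) x y :
  connect e x y -> P x -> ~ P y ->
  exists u v, [/\ connect e x u, e u v, P u & ~ P v].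
Proof.
move=> /connectP[p + ->]; elim: p x => [|z p IHp] x //= /andP[xz pth] Px nPy.
have [Pz|nPz] := pselect (P z); last by exists x, z; split=> //; exact: connect0.
have [u [v [zu uv Pu nPv]]] := IHp z pth Pz nPy.
by exists u, v; split=> //; apply: connect_trans zu; exact: connect1.
Qed.

Lemma dist_floor_le (R : realType) (a b : R) :
  `|a - b| < 1 -> `|Num.floor a - Num.floor b| <= 1.
Proof.
have /andP[al au] := floor_itv a; have /andP[bl bu] := floor_itv b.
rewrite ltr_norml => /andP[ab1 ab2].
have h1 : Num.floor a < Num.floor b + 1 + 1 by rewrite -(ltr_int R) !rmorphD /= in au bu *; lra.
have h2 : Num.floor b < Num.floor a + 1 + 1 by rewrite -(ltr_int R) !rmorphD /= in au bu *; lra.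
lia.
Qed.

Lemma dist_floor_lt (R : realType) (a b : R) (n : nat) :
  `|Num.floor a - Num.floor b| < n%:Z -> `|a - b| < n%:R.
Proof.
have /andP[al au] := floor_itv a; have /andP[bl bu] := floor_itv b => ab.
have h1 : Num.floor a + 1 <= Num.floor b + n%:Z by lia.
have h2 : Num.floor b + 1 <= Num.floor a + n%:Z by lia.
move: h1 h2; rewrite -!(ler_int R) !rmorphD /= in au bu * => h1 h2.
by rewrite ltr_norml; apply/andP; split; lra.
Qed.

(** [K] is a component from [small_component], applied to the rounded values of [s * f] on a fine
    grid. *)
Lemma chained_thin_connector (R : realType) d (f : 'rV[R]_d.+1 -> 'rV[R]_d) (r : R) :
  {within cube R d.+1, continuous f} -> 0 < r ->
  exists (i : 'I_d.+1) (K : set 'rV[R]_d.+1),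
  [/\ K `<=` cube R d.+1, K `&` face_minus R d.+1 i !=set0, K `&` face_plus R d.+1 i !=set0,
      chained r K & forall x y, K x -> K y -> ball (f x) r (f y)].
Proof.
(* On the component each coordinate of [s * f] stays within [d.+1] of its value at [x], so two
   values differ by less than [2 * d.+2 = s * r]. *)
move=> cf r0; pose s : R := 2 * d.+2%:R / r.
have s0 : 0 < s by rewrite divr_gt0 // mulr_gt0.
have si0 : 0 < s^-1 by rewrite invr_gt0.
(* Between points closer than [t], each coordinate of [s * f] changes by less than 1, hence its
   floor by at most 1. *)
have [t t0 ft] := compact_uniform (@cube_compact R d.+1) cf si0.
have [k k0 kP] : exists2 k : nat, (0 < k)%N & k%:R^-1 < t /\ k%:R^-1 < r.
  have ti0 : 0 < t^-1 by rewrite invr_gt0.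
  have ri0 : 0 < r^-1 by rewrite invr_gt0.
  have := archi_boundP (ltW (addr_gt0 ti0 ri0)); set k := Num.bound _ => ltk.
  have k0 : 0 < k.+1%:R :> R by rewrite ltr0n.
  exists k.+1 => //; rewrite -(invrK t) -[X in _ /\ _ < X](invrK r).
  by rewrite !ltf_pV2 ?posrE // -natr1; split; lra.
pose pt (v : {ffun 'I_d.+1 -> 'I_k.+1}) : 'rV[R]_d.+1 := \row_i ((v i)%:R / k%:R).
have kR0 : 0 < k%:R :> R by rewrite ltr0n.
have pt_cube v : cube R d.+1 (pt v).
  move=> i; rewrite mxE divr_ge0 //= ler_pdivrMr // mul1r ler_nat.
  by rewrite -ltnS ltn_ord.
have pt_adj u v q : k%:R^-1 < q -> grid_adj u v -> ball (pt u) q (pt v).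
  move=> kq /forallP uv; split; first by apply: lt_trans kq; rewrite invr_gt0.
  move=> i j; rewrite !mxE /ball /= -mulrBl normrM [X in _ * X]ger0_norm ?invr_ge0 ?ler0n //.
  apply: le_lt_trans kq; rewrite ler_piMl ?invr_ge0 ?ler0n //.
  rewrite ler_norml; have /andP[] := uv j.
  by rewrite -!(ler_nat R) -!natr1 => uvj vuj; apply/andP; split; lra.
pose F v a := Num.floor (s * f (pt v) ord0 a).
have F_adj u v a : grid_adj u v -> `|F u a - F v a| <= 1.
  move=> uv.
  have [_ /(_ ord0 a)] := ft _ _ (pt_cube u) (pt_cube v) (pt_adj _ _ _ kP.1 uv).
  rewrite /ball /= /F => fuv; apply: dist_floor_le.
  rewrite -mulrBr normrM (gtr0_norm s0) -(divff (lt0r_neq0 s0)) ltr_pM2l //.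
have [i [e [x [y [x0 y1 [e_sym e_adj] xy Fe]]]]] := small_component F_adj.
exists i, [set pt z | z in [set z | connect e x z]]; split.
- by move=> _ [z _ <-].
- exists (pt x); split; first by exists x => //; exact: connect0.
  by split=> //; rewrite mxE x0 mul0r.
- exists (pt y); split; first by exists y.
  by split=> //; rewrite mxE y1 /= divff // gt_eqF.
- move=> W [_ [[z xz <-] Wz]] [_ [[z' xz' <-] nWz']].
  have zz' : connect e z z'.
    by apply: connect_trans xz'; rewrite (sym_connect_sym e_sym).
  have [u [v [zu uv Wu nWv]]] := connect_exit (P := W \o pt) zz' Wz nWz'.
  have xu : connect e x u by exact: connect_trans xz zu.
  exists (pt u), (pt v); split=> //; first by exists u.
    by exists v => //; apply: connect_trans xu _; exact: connect1.
  by apply: pt_adj kP.2 _; exact: e_adj.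
move=> _ _ [z xz <-] [z' xz' <-]; split=> // i0 a; rewrite ord1 /ball /=.
have near_x u : connect e x u -> s * `|f (pt u) ord0 a - f (pt x) ord0 a| < d.+1%:R.
  by move=> /(Fe u a)/dist_floor_lt; rewrite -mulrBr normrM (gtr0_norm s0).
have fz := near_x z xz; have fz' := near_x z' xz'.
have : s * `|f (pt z) ord0 a - f (pt z') ord0 a| < s * r.
  have -> : s * r = 2 * d.+2%:R by rewrite /s divfK // gt_eqF.
  rewrite -[f (pt z) ord0 a](subrK (f (pt x) ord0 a)) -addrA.
  apply: le_lt_trans (ler_wpM2l (ltW s0) (ler_normD _ _)) _.
  rewrite mulrDr [X in _ + s * X]distrC.
  by move: fz fz'; rewrite -[d.+2%:R]natr1; lra.
by rewrite ltr_pM2l.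
Qed.

(** * The limit set and the value of [f] on it *)

Theorem theoremB (R : realType) (n : nat) (hn : (0 < n)%N)
  (f : 'rV[R]_n -> 'rV[R]_(n.-1))
  (hf : {within cube R n, continuous f}) :
  exists (p : 'rV[R]_(n.-1)) (S : set 'rV[R]_n),
    compact S /\ S `<=` cube R n `&` f @^-1` [set p] /\
    connects_opposite_faces R n S.
Proof.
case: n hn f hf => // d _ f cf.
have e0 m : 0 < m.+1%:R^-1 :> R by rewrite invr_gt0.
have [i iE] := choice (fun m => chained_thin_connector cf (e0 m)).
have [K KE] := choice iE.
have [U UU Ue] := ultra_natSinv R; have PU := @ultra_proper _ _ UU.
have KC m : K m `<=` cube R d.+1 by have [] := KE m.
have Kch m : chained m.+1%:R^-1 (K m) by have [] := KE m.
have Kf m x y : K m x -> K m y -> ball (f x) m.+1%:R^-1 (f y).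
  by have [_ _ _ _] := KE m; apply.
(* The direction [i m] depends on [m]; as there are finitely many, [U] selects one [j]. *)
have [j Uj] : exists j, U [set m | i m = j].
  apply: contrapT => no_j.
  have U' j : U [set m | i m <> j].
    by have [Uj|//] := in_ultra_setVsetC [set m | i m = j] UU; case: no_j; exists j.
  have Uall : U [set m | forall j, i m <> j].
    by apply: (filter_forall (f := fun j => [set m | i m <> j])).
  by have [m /(_ (i m))] := filter_ex Uall.
have Kminus m : K m `&` face_minus R d.+1 (i m) !=set0 by have [] := KE m.
have Kplus m : K m `&` face_plus R d.+1 (i m) !=set0 by have [] := KE m.
have [[a aE] [b bE]] := (choice Kminus, choice Kplus).
have [x Cx ax] := ultra_seq_cvg UU (@cube_compact R d.+1) (fun m => KC m _ (aE m).1).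
have [y Cy bx] := ultra_seq_cvg UU (@cube_compact R d.+1) (fun m => KC m _ (bE m).1).
have face (u : nat -> 'rV[R]_d.+1) (z : 'rV[R]_d.+1) (v : R) :
    u @ U --> z -> (forall m, u m ord0 (i m) = v) -> z ord0 j = v.
  move=> uz uv; apply/eqP; rewrite -subr_eq0 -normr_le0; apply/ler_addgt0Pr => r r0.
  have Uz : U [set m | ball z r (u m)] := uz _ (nbhsx_ballx z _ r0).
  have [m [/= mj [_ /(_ ord0 j)]]] := filter_ex (filterI Uj Uz).
  by rewrite /ball /= -mj uv add0r => /ltW.
pose S := ultra_limit U K.
have SC : S `<=` cube R d.+1.
  move=> z Sz; apply: cube_closed => N /Sz /filter_ex[m [w [Kw Nw]]].
  by exists w; split=> //; exact: KC Kw.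
exists (f x), S; split.
  by apply: (subclosed_compact _ (@cube_compact R d.+1) SC); exact: ultra_limit_closed.
split; last split.
- move=> z Sz; split; first exact: SC.
  (* Compare [f z] with [f w] for some [w] in [K m] near [z], then with [f (a m)], then with
     [f x]. *)
  have close r : 0 < r -> ball (f z) (r + (r + r)) (f x).
    move=> r0.
    have U1 : U [set m | ball (f x) r (f (a m))].
      by apply: (within_continuous_seq _ cf (fun m => KC m _ (aE m).1) Cx ax
        (nbhsx_ballx (f x) _ r0)).
    have Nz : nbhs z [set w | cube R d.+1 w -> ball (f z) r (f w)].
      by move/subspace_continuousP: cf => /(_ z (SC _ Sz) _ (nbhsx_ballx (f z) _ r0)).
    have [m [[m1 [w [Kw zw]]] mr]] := filter_ex (filterI (filterI U1 (Sz _ Nz)) (Ue r r0)).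
    apply: (ball_triangle (zw (KC m _ Kw))).
    apply: (@ball_triangle _ _ (f (a m))); last exact: ball_sym.
    by apply: (le_ball (ltW mr)); apply: Kf => //; exact: (aE m).1.
  rewrite /=; apply/rowP => l; apply/eqP; rewrite -subr_eq0 -normr_le0.
  apply/ler_addgt0Pr => r r0; rewrite add0r.
  have r3 : 0 < r / 3 by rewrite divr_gt0.
  have [_ /(_ ord0 l)] := close _ r3; rewrite /ball /= => /ltW/le_trans; apply; lra.
- exact: (ultra_limit_connected UU Ue (@cube_compact R d.+1) KC Kch).
exists j; split.
  exists x; split; last by split=> //; apply: (face a) => // m; exact: (aE m).2.2.
  by apply: (ultra_limit_mem UU _ ax); apply: filterE => m; exact: (aE m).1.
exists y; split; last by split=> //; apply: (face b) => // m; exact: (bE m).2.2.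
by apply: (ultra_limit_mem UU _ bx); apply: filterE => m; exact: (bE m).1.
Qed.
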